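(* For any odd positive integer $k$, the following identity holds in $\mathrm{End}_{\mathcal{AB}}(\mathsf 0)$: $$2\Delta_k=-\Delta_{k-1}+\sum_{j=1}^{k}(-1)^{j-1}\Delta_{j-1}\Delta_{k-j}.$$
   Context: $\kappa$ is a commutative ring with $1$ in which $2$ is invertible. The affine Brauer category $\mathcal{AB}$ is the $\kappa$-linear strict monoidal category generated by one object $\mathsf 1$ (objects $\mathsf m:=\mathsf 1^{\otimes m}$, $m\ge0$; $\mathsf 0$ is the unit object) and morphisms $U:\mathsf 0\to\mathsf 2$, $A:\mathsf 2\to\mathsf 0$, $S:\mathsf 2\to\mathsf 2$, $X:\mathsf 1\to\mathsf 1$ subject to $S\circ S=1_{\mathsf 2}$; $(S\otimes 1_{\mathsf 1})\circ(1_{\mathsf 1}\otimes S)\circ(S\otimes 1_{\mathsf 1})=(1_{\mathsf 1}\otimes S)\circ(S\otimes 1_{\mathsf 1})\circ(1_{\mathsf 1}\otimes S)$; $(1_{\mathsf 1}\otimes A)\circ(U\otimes 1_{\mathsf 1})=1_{\mathsf 1}=(A\otimes 1_{\mathsf 1})\circ(1_{\mathsf 1}\otimes U)$; $U=S\circ U$; $A=A\circ S$; $(A\otimes 1_{\mathsf 1})\circ(1_{\mathsf 1}\otimes S)=(1_{\mathsf 1}\otimes A)\circ(S\otimes 1_{\mathsf 1})$; $(S\otimes 1_{\mathsf 1})\circ(1_{\mathsf 1}\otimes U)=(1_{\mathsf 1}\otimes S)\circ(U\otimes 1_{\mathsf 1})$; $(X\otimes 1_{\mathsf 1})\circ S-S\circ(1_{\mathsf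 1}\otimes X)=U\circ A-1_{\mathsf 2}$; $(1_{\mathsf 1}\otimes A)\circ(1_{\mathsf 1}\otimes X\otimes 1_{\mathsf 1})\circ(U\otimes 1_{\mathsf 1})=-X=(A\otimes 1_{\mathsf 1})\circ(1_{\mathsf 1}\otimes X\otimes 1_{\mathsf 1})\circ(1_{\mathsf 1}\otimes U)$. For $k\ge0$, $\Delta_k:=A\circ(X\otimes 1_{\mathsf 1})^k\circ U\in\mathrm{End}_{\mathcal{AB}}(\mathsf 0)$. $\Delta_k\Delta_l$ denotes $\Delta_k\circ\Delta_l=\Delta_k\otimes\Delta_l$ (the algebra $\mathrm{End}_{\mathcal{AB}}(\mathsf 0)$ is commutative). *)

(* Defs.v *)
From HB Require Import structures.
From mathcomp Require Import all_boot all_algebra.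
From mathcomp Require Import boolp.

Set Implicit Arguments.
Unset Strict Implicit.
Unset Printing Implicit Defensive.

Import GRing.Theory.
Local Open Scope ring_scope.
Local Open Scope quotient_scope.

Declare Scope AB_scope.
Delimit Scope AB_scope with AB.

(** The affine Brauer category over [K], built from its presentation.
    The objects are the [m]-fold tensor powers of the generating object, so
    they are natural numbers, with [addn] as tensor product and [0] as unit.
    The morphisms [m -> n] are the well-typed expressions [ABterm K m n] in the
    operations of a K-linear strict monoidal category and in the generators,
    modulo the congruence [ABrel] generated by the axioms of such categories
    and the defining relations. *)

Inductive ABterm (K : Type) : nat -> nat -> Type :=
| Tzero m n : ABterm K m n
| Topp m n : ABterm K m n -> ABterm K m n
| Tadd m n : ABterm K m n -> ABterm K m n -> ABterm K m n
| Tscale m n : K -> ABterm K m n -> ABterm K m n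
| Tid m : ABterm K m m
| Tcomp m n p : ABterm K n p -> ABterm K m n -> ABterm K m p
| Ttens m n p q : ABterm K m n -> ABterm K p q -> ABterm K (m + p) (n + q)
| TU : ABterm K 0 2
| TA : ABterm K 2 0
| TS : ABterm K 2 2
| TX : ABterm K 1 1.

Arguments Tzero {K m n}.
Arguments Tid {K} m.
Arguments TU {K}.
Arguments TA {K}.
Arguments TS {K}.
Arguments TX {K}.

(* Transport along equalities of objects, as in [castmx]: the two sides of the
   strict associativity and right unit laws have types which are provably but
   not definitionally equal. *)
Definition Tcast (K : Type) m n m' n' (eq_mn : (m = m') * (n = n'))
    (f : ABterm K m n) : ABterm K m' n' :=
  let: erefl in _ = m' := eq_mn.1 return ABterm K m' n' in
  let: erefl in _ = n' := eq_mn.2 return ABterm K m n' in f.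

Section Congruence.

Variable K : comPzRingType.

Local Notation "f + g" := (Tadd f g) : AB_scope.
Local Notation "- f" := (Topp f) : AB_scope.
Local Notation "a *: f" := (Tscale a f) : AB_scope.
Local Notation "0" := Tzero : AB_scope.
Local Notation "g ∘ f" := (Tcomp g f) (at level 40, left associativity)
  : AB_scope.
Local Notation "f ⊗ g" := (Ttens f g) (at level 39, left associativity)
  : AB_scope.
Reserved Notation "f ≡ g" (at level 70).

Inductive ABrel : forall m n, ABterm K m n -> ABterm K m n -> Prop :=
| rel_refl m n (f : ABterm K m n) : f ≡ f
| rel_sym m n (f g : ABterm K m n) : f ≡ g -> g ≡ f
| rel_trans m n (f g h : ABterm K m n) : f ≡ g -> g ≡ h -> f ≡ h
| rel_opp m n (f f' : ABterm K m n) : f ≡ f' -> - f ≡ - f'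
| rel_add m n (f f' g g' : ABterm K m n) :
    f ≡ f' -> g ≡ g' -> f + g ≡ f' + g'
| rel_scale m n a (f f' : ABterm K m n) : f ≡ f' -> a *: f ≡ a *: f'
| rel_comp m n p (g g' : ABterm K n p) (f f' : ABterm K m n) :
    g ≡ g' -> f ≡ f' -> g ∘ f ≡ g' ∘ f'
| rel_tens m n p q (f f' : ABterm K m n) (g g' : ABterm K p q) :
    f ≡ f' -> g ≡ g' -> f ⊗ g ≡ f' ⊗ g'
| rel_addA m n (f g h : ABterm K m n) : f + (g + h) ≡ f + g + h
| rel_addC m n (f g : ABterm K m n) : f + g ≡ g + f
| rel_add0 m n (f : ABterm K m n) : 0 + f ≡ f
| rel_addN m n (f : ABterm K m n) : - f + f ≡ 0
| rel_scaleA m n a b (f : ABterm K m n) : a *: (b *: f) ≡ (a * b)%R *: f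
| rel_scale1 m n (f : ABterm K m n) : 1%R *: f ≡ f
| rel_scaleDr m n a (f g : ABterm K m n) : a *: (f + g) ≡ a *: f + a *: g
| rel_scaleDl m n a b (f : ABterm K m n) :
    (a + b)%R *: f ≡ a *: f + b *: f
| rel_compDl m n p (g g' : ABterm K n p) (f : ABterm K m n) :
    (g + g') ∘ f ≡ g ∘ f + g' ∘ f
| rel_compDr m n p (g : ABterm K n p) (f f' : ABterm K m n) :
    g ∘ (f + f') ≡ g ∘ f + g ∘ f'
| rel_compZl m n p a (g : ABterm K n p) (f : ABterm K m n) :
    (a *: g) ∘ f ≡ a *: (g ∘ f)
| rel_compZr m n p a (g : ABterm K n p) (f : ABterm K m n) :
    g ∘ (a *: f) ≡ a *: (g ∘ f)
| rel_tensDl m n p q (f f' : ABterm K m n) (g : ABterm K p q) :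
    (f + f') ⊗ g ≡ f ⊗ g + f' ⊗ g
| rel_tensDr m n p q (f : ABterm K m n) (g g' : ABterm K p q) :
    f ⊗ (g + g') ≡ f ⊗ g + f ⊗ g'
| rel_tensZl m n p q a (f : ABterm K m n) (g : ABterm K p q) :
    (a *: f) ⊗ g ≡ a *: (f ⊗ g)
| rel_tensZr m n p q a (f : ABterm K m n) (g : ABterm K p q) :
    f ⊗ (a *: g) ≡ a *: (f ⊗ g)
| rel_compA m n p q (h : ABterm K p q) (g : ABterm K n p) (f : ABterm K m n) :
    h ∘ (g ∘ f) ≡ h ∘ g ∘ f
| rel_comp1l m n (f : ABterm K m n) : Tid n ∘ f ≡ f
| rel_comp1r m n (f : ABterm K m n) : f ∘ Tid m ≡ f
| rel_tens_id m n : Tid m ⊗ Tid n ≡ Tid (m + n)%N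
| rel_tens_comp m n p m' n' p' (g : ABterm K n p) (f : ABterm K m n)
    (g' : ABterm K n' p') (f' : ABterm K m' n') :
    (g ∘ f) ⊗ (g' ∘ f') ≡ (g ⊗ g') ∘ (f ⊗ f')
| rel_tensA m n p q r s
    (f : ABterm K m n) (g : ABterm K p q) (h : ABterm K r s) :
    Tcast (addnA m p r, addnA n q s) (f ⊗ (g ⊗ h)) ≡ f ⊗ g ⊗ h
| rel_tens1l m n (f : ABterm K m n) : Tid 0 ⊗ f ≡ f
| rel_tens1r m n (f : ABterm K m n) :
    Tcast (addn0 m, addn0 n) (f ⊗ Tid 0) ≡ f
| rel_SS : TS ∘ TS ≡ Tid 2
| rel_braid :
    (TS ⊗ Tid 1) ∘ (Tid 1 ⊗ TS) ∘ (TS ⊗ Tid 1)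
    ≡ (Tid 1 ⊗ TS) ∘ (TS ⊗ Tid 1) ∘ (Tid 1 ⊗ TS)
| rel_snakel : (Tid 1 ⊗ TA) ∘ (TU ⊗ Tid 1) ≡ Tid 1
| rel_snaker : (TA ⊗ Tid 1) ∘ (Tid 1 ⊗ TU) ≡ Tid 1
| rel_SU : TU ≡ TS ∘ TU
| rel_AS : TA ≡ TA ∘ TS
| rel_pitchforkA :
    (TA ⊗ Tid 1) ∘ (Tid 1 ⊗ TS) ≡ (Tid 1 ⊗ TA) ∘ (TS ⊗ Tid 1)
| rel_pitchforkU :
    (TS ⊗ Tid 1) ∘ (Tid 1 ⊗ TU) ≡ (Tid 1 ⊗ TS) ∘ (TU ⊗ Tid 1)
| rel_XS :
    (TX ⊗ Tid 1) ∘ TS + - (TS ∘ (Tid 1 ⊗ TX)) ≡ TU ∘ TA + - Tid 2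
| rel_Xrotl :
    (Tid 1 ⊗ TA) ∘ (Tid 1 ⊗ TX ⊗ Tid 1) ∘ (TU ⊗ Tid 1) ≡ - TX
| rel_Xrotr :
    (TA ⊗ Tid 1) ∘ (Tid 1 ⊗ TX ⊗ Tid 1) ∘ (Tid 1 ⊗ TU) ≡ - TX
where "f ≡ g" := (ABrel f%AB g%AB).

End Congruence.

HB.instance Definition _ (K : Type) m n := gen_eqMixin (ABterm K m n).
HB.instance Definition _ (K : Type) m n := gen_choiceMixin (ABterm K m n).

Section Quotient.

Variable K : comPzRingType.

Section Hom.

Variables m n : nat.

Definition ABrelb (f g : ABterm K m n) : bool := `[< ABrel f g >].

Fact ABrelb_refl : reflexive ABrelb.
Proof. by move=> f; apply/asboolP/rel_refl. Qed.

Fact ABrelb_sym : symmetric ABrelb.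
Proof. by move=> f g; apply/asboolP/asboolP; apply: rel_sym. Qed.

Fact ABrelb_trans : transitive ABrelb.
Proof.
move=> g f h /asboolP fg /asboolP gh.
by apply/asboolP; apply: rel_trans fg gh.
Qed.

Canonical ABrelb_equiv := EquivRel ABrelb ABrelb_refl ABrelb_sym ABrelb_trans.

Definition ABhom : Type := {eq_quot ABrelb}.

HB.instance Definition _ := Choice.on ABhom.
HB.instance Definition _ := EqQuotient.on ABhom.

Lemma ABhom_eqP (f g : ABterm K m n) : \pi_ABhom f = \pi_ABhom g <-> ABrel f g.
Proof.
split=> [/eqP|fg]; first by rewrite [_ == _]piE => /asboolP.
by apply/eqP; rewrite [_ == _]piE; apply/asboolP.
Qed.

Lemma ABrel_repr (f : ABterm K m n) : ABrel (repr (\pi_ABhom f)) f.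
Proof. by apply/ABhom_eqP; rewrite reprK. Qed.

Definition ABzero : ABhom := \pi_ABhom Tzero.
Definition ABopp (f : ABhom) : ABhom := \pi_ABhom (Topp (repr f)).
Definition ABadd (f g : ABhom) : ABhom := \pi_ABhom (Tadd (repr f) (repr g)).
Definition ABscale (a : K) (f : ABhom) : ABhom :=
  \pi_ABhom (Tscale a (repr f)).

Lemma pi_ABopp f : \pi_ABhom (Topp f) = ABopp (\pi_ABhom f).
Proof. exact/ABhom_eqP/rel_opp/rel_sym/ABrel_repr. Qed.

Lemma pi_ABadd f g : \pi_ABhom (Tadd f g) = ABadd (\pi_ABhom f) (\pi_ABhom g).
Proof. by apply/ABhom_eqP/rel_add; apply/rel_sym/ABrel_repr. Qed.

Lemma pi_ABscale a f : \pi_ABhom (Tscale a f) = ABscale a (\pi_ABhom f).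
Proof. exact/ABhom_eqP/rel_scale/rel_sym/ABrel_repr. Qed.

Lemma ABhomW (P : ABhom -> Prop) :
  (forall f, P (\pi_ABhom f)) -> forall f, P f.
Proof. by move=> Ppi f; rewrite -[f]reprK; apply: Ppi. Qed.

Fact ABaddA : associative ABadd.
Proof.
elim/ABhomW=> f; elim/ABhomW=> g; elim/ABhomW=> h.
by rewrite -!pi_ABadd; apply/ABhom_eqP/rel_addA.
Qed.

Fact ABaddC : commutative ABadd.
Proof.
elim/ABhomW=> f; elim/ABhomW=> g.
by rewrite -!pi_ABadd; apply/ABhom_eqP/rel_addC.
Qed.

Fact ABadd0 : left_id ABzero ABadd.
Proof. by elim/ABhomW=> f; rewrite -pi_ABadd; apply/ABhom_eqP/rel_add0. Qed.

Fact ABaddN : left_inverse ABzero ABopp ABadd.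
Proof.
by elim/ABhomW=> f; rewrite -pi_ABopp -pi_ABadd; apply/ABhom_eqP/rel_addN.
Qed.

HB.instance Definition _ :=
  GRing.isZmodule.Build ABhom ABaddA ABaddC ABadd0 ABaddN.

Fact ABscaleA a b f : ABscale a (ABscale b f) = ABscale (a * b) f.
Proof.
by elim/ABhomW: f => f; rewrite -!pi_ABscale; apply/ABhom_eqP/rel_scaleA.
Qed.

Fact ABscale1 : left_id 1 ABscale.
Proof. by elim/ABhomW=> f; rewrite -pi_ABscale; apply/ABhom_eqP/rel_scale1. Qed.

Fact ABscaleDr : right_distributive ABscale ABadd.
Proof.
move=> a; elim/ABhomW=> f; elim/ABhomW=> g.
by rewrite -pi_ABadd -!pi_ABscale -pi_ABadd; apply/ABhom_eqP/rel_scaleDr.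
Qed.

Fact ABscaleDl f a b : ABscale (a + b) f = ABadd (ABscale a f) (ABscale b f).
Proof.
elim/ABhomW: f => f.
by rewrite -!pi_ABscale -pi_ABadd; apply/ABhom_eqP/rel_scaleDl.
Qed.

HB.instance Definition _ := GRing.Zmodule_isLmodule.Build K ABhom
  ABscaleA ABscale1 ABscaleDr ABscaleDl.

Lemma ABpi_zero : \pi_ABhom Tzero = 0.
Proof. by []. Qed.

Lemma ABpi_opp f : \pi_ABhom (Topp f) = - \pi_ABhom f.
Proof. exact: pi_ABopp. Qed.

Lemma ABpi_add f g : \pi_ABhom (Tadd f g) = \pi_ABhom f + \pi_ABhom g.
Proof. exact: pi_ABadd. Qed.

Lemma ABpi_scale a f : \pi_ABhom (Tscale a f) = a *: \pi_ABhom f.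
Proof. exact: pi_ABscale. Qed.

End Hom.

Definition ABid m : ABhom m m := \pi_(ABhom m m) (Tid m).

Definition ABcomp m n p (g : ABhom n p) (f : ABhom m n) : ABhom m p :=
  \pi_(ABhom m p) (Tcomp (repr g) (repr f)).

Definition ABtens m n p q (f : ABhom m n) (g : ABhom p q) :
    ABhom (m + p) (n + q) :=
  \pi_(ABhom (m + p) (n + q)) (Ttens (repr f) (repr g)).

Definition ABU : ABhom 0 2 := \pi_(ABhom 0 2) TU.
Definition ABA : ABhom 2 0 := \pi_(ABhom 2 0) TA.
Definition ABS : ABhom 2 2 := \pi_(ABhom 2 2) TS.
Definition ABX : ABhom 1 1 := \pi_(ABhom 1 1) TX.

Lemma ABpi_comp m n p (g : ABterm K n p) (f : ABterm K m n) :
  \pi_(ABhom m p) (Tcomp g f) = ABcomp (\pi_(ABhom n p) g) (\pi_(ABhom m n) f).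
Proof. by apply/ABhom_eqP/rel_comp; apply/rel_sym/ABrel_repr. Qed.

Lemma ABpi_tens m n p q (f : ABterm K m n) (g : ABterm K p q) :
  \pi_(ABhom (m + p) (n + q)) (Ttens f g)
  = ABtens (\pi_(ABhom m n) f) (\pi_(ABhom p q) g).
Proof. by apply/ABhom_eqP/rel_tens; apply/rel_sym/ABrel_repr. Qed.

End Quotient.

Arguments ABid {K} m.
Arguments ABU {K}.
Arguments ABA {K}.
Arguments ABS {K}.
Arguments ABX {K}.

Notation "g ∘ f" := (ABcomp g f) (at level 40, left associativity) : AB_scope.
Notation "f ⊗ g" := (ABtens f g) (at level 39, left associativity) : AB_scope.

Definition ABpow (K : comPzRingType) m (f : ABhom K m m) (k : nat) :
    ABhom K m m :=
  iter k (ABcomp f) (ABid m).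

Definition Delta (K : comPzRingType) (k : nat) : ABhom K 0 0 :=
  (ABA ∘ ABpow (ABX ⊗ ABid 1) k ∘ ABU)%AB.

Arguments Delta {K} k.

(* Main.v *)
Require Import Defs.
From mathcomp Require Import all_boot all_algebra.

Import GRing.Theory.

Local Open Scope ring_scope.
Local Open Scope quotient_scope.

(** Write [x] and [y] for the endomorphisms of the object 2 carrying a dot on
    the left, resp. right, strand, [A], [U] and [S] for the cap, the cup and the
    crossing.  Consider the closed diagram [F a b = A x^a S y^b U], a loop with
    one crossing, [a] dots above the crossing and [b] below.  With all dots on
    one side, the crossing is absorbed by the cup or by the cap, which gives
    [F k 0 = Delta k] and [F 0 k = A y^k U].  A dot slides
    over the cap at the cost of a sign, [A y = - A x] ([cap_slide_dot]), so that
    [F 0 k = (-1)^k Delta k].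

    Moving a single dot through the crossing by [x S = S y + U A - 1] changes
    [F] by a split loop minus a loop without crossing
    ([crossed_loop_step]):
      [F (a+1) b - F a (b+1) = (-1)^b (Delta a Delta b - Delta (a+b))].
    Telescoping along [a + b = k - 1] yields, for every [k],
      [Delta k - (-1)^k Delta k
         = \sum_(a < k) (-1)^(k-1-a) (Delta a Delta (k-1-a) - Delta (k-1))]
    ([Delta_telescope]).  For odd [k] the left side is [2 Delta k], the signs
    become [(-1)^a], and their sum is 1. *)

(** * The monoidal structure on quotient morphisms *)

Section Category.

Variable K : comPzRingType.

Local Open Scope AB_scope.
Local Notation hom := (ABhom K).

Lemma ABcompA m n p q (h : hom p q) (g : hom n p) (f : hom m n) :
  h ∘ (g ∘ f) = h ∘ g ∘ f.
Proof.
elim/ABhomW: h => h; elim/ABhomW: g => g; elim/ABhomW: f => f.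
by rewrite -!ABpi_comp; apply/ABhom_eqP/rel_compA.
Qed.

Lemma ABcomp1l {m n} (f : hom m n) : ABid n ∘ f = f.
Proof. by elim/ABhomW: f => f; rewrite -ABpi_comp; apply/ABhom_eqP/rel_comp1l. Qed.

Lemma ABcomp1r {m n} (f : hom m n) : f ∘ ABid m = f.
Proof. by elim/ABhomW: f => f; rewrite -ABpi_comp; apply/ABhom_eqP/rel_comp1r. Qed.

Lemma ABcompDl m n p (g g' : hom n p) (f : hom m n) :
  (g + g') ∘ f = g ∘ f + g' ∘ f.
Proof.
elim/ABhomW: g => g; elim/ABhomW: g' => g'; elim/ABhomW: f => f.
by rewrite -ABpi_add -!ABpi_comp -ABpi_add; apply/ABhom_eqP/rel_compDl.
Qed.

Lemma ABcompDr m n p (g : hom n p) (f f' : hom m n) :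
  g ∘ (f + f') = g ∘ f + g ∘ f'.
Proof.
elim/ABhomW: g => g; elim/ABhomW: f' => f'; elim/ABhomW: f => f.
by rewrite -ABpi_add -!ABpi_comp -ABpi_add; apply/ABhom_eqP/rel_compDr.
Qed.

Lemma ABcompZl m n p a (g : hom n p) (f : hom m n) : (a *: g) ∘ f = a *: (g ∘ f).
Proof.
elim/ABhomW: g => g; elim/ABhomW: f => f.
by rewrite -ABpi_scale -!ABpi_comp -ABpi_scale; apply/ABhom_eqP/rel_compZl.
Qed.

Lemma ABcompZr m n p a (g : hom n p) (f : hom m n) : g ∘ (a *: f) = a *: (g ∘ f).
Proof.
elim/ABhomW: g => g; elim/ABhomW: f => f.
by rewrite -ABpi_scale -!ABpi_comp -ABpi_scale; apply/ABhom_eqP/rel_compZr.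
Qed.

Lemma ABcompNl m n p (g : hom n p) (f : hom m n) : (- g) ∘ f = - (g ∘ f).
Proof. by rewrite -scaleN1r ABcompZl scaleN1r. Qed.

Lemma ABcompNr m n p (g : hom n p) (f : hom m n) : g ∘ (- f) = - (g ∘ f).
Proof. by rewrite -scaleN1r ABcompZr scaleN1r. Qed.

Lemma ABtensZl m n p q a (f : hom m n) (g : hom p q) :
  (a *: f) ⊗ g = a *: (f ⊗ g).
Proof.
elim/ABhomW: g => g; elim/ABhomW: f => f.
by rewrite -ABpi_scale -!ABpi_tens -ABpi_scale; apply/ABhom_eqP/rel_tensZl.
Qed.

Lemma ABtensNl m n p q (f : hom m n) (g : hom p q) : (- f) ⊗ g = - (f ⊗ g).
Proof. by rewrite -scaleN1r ABtensZl scaleN1r. Qed.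

Lemma ABtens_id m n : ABid m ⊗ ABid n = ABid (m + n) :> hom _ _.
Proof. by rewrite -ABpi_tens; apply/ABhom_eqP/rel_tens_id. Qed.

Lemma ABtens_comp m n p m' n' p' (g : hom n p) (f : hom m n)
    (g' : hom n' p') (f' : hom m' n') :
  (g ∘ f) ⊗ (g' ∘ f') = (g ⊗ g') ∘ (f ⊗ f').
Proof.
elim/ABhomW: g => g; elim/ABhomW: f => f.
elim/ABhomW: g' => g'; elim/ABhomW: f' => f'.
rewrite -2!ABpi_comp -3!ABpi_tens -ABpi_comp.
exact/ABhom_eqP/rel_tens_comp.
Qed.

Lemma ABtens1l m n (f : hom m n) : ABid 0 ⊗ f = f.
Proof. by elim/ABhomW: f => f; rewrite -ABpi_tens; apply/ABhom_eqP/rel_tens1l. Qed.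

Lemma Tcast_id m n (e : (m = m) * (n = n)) (f : ABterm K m n) : Tcast e f = f.
Proof. by case: e => e1 e2; rewrite (eq_axiomK e1) (eq_axiomK e2). Qed.

Definition ABcast {m n m' n'} (e : (m = m') * (n = n')) (f : hom m n) : hom m' n' :=
  \pi_(hom m' n') (Tcast e (repr f)).

(** On objects given by numerals the source and target of the two sides of the
    strict associativity and unit laws are convertible, and this lemma then
    removes the transport. *)
Lemma ABcast_id m n (e : (m = m) * (n = n)) (f : hom m n) : ABcast e f = f.
Proof. by rewrite /ABcast Tcast_id reprK. Qed.

Lemma ABpi_cast m n m' n' (e : (m = m') * (n = n')) (f : ABterm K m n) :
  \pi_(hom m' n') (Tcast e f) = ABcast e (\pi_(hom m n) f).
Proof.
case: e => e1 e2; case: _ / e1; case: _ / e2.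
by rewrite ABcast_id Tcast_id.
Qed.

Lemma ABtensA m n p q r s (f : hom m n) (g : hom p q) (h : hom r s) :
  ABcast (addnA m p r, addnA n q s) (f ⊗ (g ⊗ h)) = f ⊗ g ⊗ h.
Proof.
elim/ABhomW: f => f; elim/ABhomW: g => g; elim/ABhomW: h => h.
by rewrite -!ABpi_tens -ABpi_cast; apply/ABhom_eqP/rel_tensA.
Qed.

Lemma ABtens1r m n (f : hom m n) : ABcast (addn0 m, addn0 n) (f ⊗ ABid 0) = f.
Proof.
elim/ABhomW: f => f.
by rewrite -ABpi_tens -ABpi_cast; apply/ABhom_eqP/rel_tens1r.
Qed.

Lemma ABpowS m (f : hom m m) k : ABpow f k.+1 = f ∘ ABpow f k.
Proof. by []. Qed.

Lemma ABpowSr m (f : hom m m) k : ABpow f k.+1 = ABpow f k ∘ f.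
Proof.
elim: k => [|k IHk]; first by rewrite ABpowS ABcomp1l ABcomp1r.
by rewrite ABpowS {1}IHk ABcompA.
Qed.

Lemma ABpow_comm m (f g : hom m m) k :
  f ∘ g = g ∘ f -> f ∘ ABpow g k = ABpow g k ∘ f.
Proof.
move=> fg; elim: k => [|k IHk]; first by rewrite ABcomp1l ABcomp1r.
by rewrite ABpowS ABcompA fg -ABcompA IHk ABcompA.
Qed.

(** * Dots on caps, cups and crossings *)

Local Notation U := (@ABU K).
Local Notation A := (@ABA K).
Local Notation S := (@ABS K).
Local Notation X := (@ABX K).
Local Notation I := (@ABid K 1).
Local Notation x := (X ⊗ I : hom 2 2).
Local Notation y := (I ⊗ X : hom 2 2).
Local Notation Delta k := (@Delta K k).

Lemma cap_crossing : A ∘ S = A.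
Proof. by have /ABhom_eqP := rel_AS K; rewrite ABpi_comp. Qed.

Lemma crossing_cup : S ∘ U = U.
Proof. by have /ABhom_eqP := rel_SU K; rewrite ABpi_comp. Qed.

Lemma dot_crossing : x ∘ S = S ∘ y + (U ∘ A - ABid 2).
Proof.
have /ABhom_eqP := rel_XS K.
rewrite !ABpi_add !ABpi_opp !ABpi_comp ABpi_tens.
(* The instance is given in full because the object [2] of the goal matches
   the [1 + 1] of a tensor product only up to conversion. *)
rewrite (ABpi_tens (Tid 1) TX) => XS.
rewrite -[U ∘ A - _]XS; exact/esym/subrKC.
Qed.

Lemma snake : (I ⊗ A) ∘ (U ⊗ I) = I.
Proof.
have /ABhom_eqP := rel_snakel K.
by rewrite ABpi_comp (ABpi_tens (Tid 1) TA) (ABpi_tens TU (Tid 1)).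
Qed.

Lemma dot_rotate : (A ⊗ I) ∘ (I ⊗ X ⊗ I) ∘ (I ⊗ U) = - X.
Proof.
have /ABhom_eqP := rel_Xrotr K; rewrite ABpi_opp !ABpi_comp.
rewrite (ABpi_tens TA (Tid 1)) (ABpi_tens (Tid 1) TU).
by rewrite (ABpi_tens (Ttens (Tid 1) TX) (Tid 1)) (ABpi_tens (Tid 1) TX).
Qed.

(** Both sides are [A ⊗ A], two caps side by side at different heights. *)
Lemma cap_cap : A ∘ (A ⊗ ABid 2) = A ∘ (ABid 2 ⊗ A).
Proof.
have A1r : A ⊗ ABid 0 = A by rewrite -[RHS]ABtens1r ABcast_id.
have := ABtens_comp _ _ _ _ _ _ (ABid 0) A A (ABid 2).
rewrite ABcomp1l ABcomp1r ABtens1l => <-.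
have := ABtens_comp _ _ _ _ _ _ A (ABid 2) (ABid 0) A.
by rewrite ABcomp1l ABcomp1r A1r.
Qed.

(** A morphism slides over the cap at the price of a rotation.  The rotated [f]
    consists of a cap over the strand carrying [f] and the left leg of a cup.
    The outer cap joins the right leg of that cup to the strand on the right;
    moving it below the inner cap straightens this zigzag, and the inner cap is
    what remains. *)
Lemma cap_slide (f : hom 1 1) :
  A ∘ (((A ⊗ I) ∘ (I ⊗ f ⊗ I) ∘ (I ⊗ U)) ⊗ I) = A ∘ (I ⊗ f).
Proof.
have rotated2 : ((A ⊗ I) ∘ (I ⊗ f ⊗ I) ∘ (I ⊗ U)) ⊗ I
    = (A ⊗ ABid 2) ∘ ((I ⊗ f) ⊗ ABid 2) ∘ (I ⊗ (U ⊗ I)).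
  (* Over the numeral objects both bracketings have convertible types. *)
  have -> : A ⊗ ABid 2 = A ⊗ I ⊗ I by rewrite -ABtensA ABcast_id ABtens_id.
  have -> : (I ⊗ f) ⊗ ABid 2 = I ⊗ f ⊗ I ⊗ I.
    by rewrite -(ABtensA _ _ _ _ _ _ (I ⊗ f)) ABcast_id ABtens_id.
  have -> : I ⊗ (U ⊗ I) = I ⊗ U ⊗ I by rewrite -ABtensA ABcast_id.
  rewrite -[X in _ ⊗ X = _](ABcomp1l I) ABtens_comp.
  by rewrite -[X in (_ ⊗ X) ∘ _ = _](ABcomp1l I) ABtens_comp.
have cap_through : (ABid 2 ⊗ A) ∘ ((I ⊗ f) ⊗ ABid 2) = (I ⊗ f) ∘ (I ⊗ (I ⊗ A)).
  have -> : I ⊗ (I ⊗ A) = ABid 2 ⊗ A.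
    by have := ABtensA _ _ _ _ _ _ I I A; rewrite ABcast_id ABtens_id.
  have f0 : (I ⊗ f) ⊗ ABid 0 = I ⊗ f by rewrite -[RHS]ABtens1r ABcast_id.
  have := ABtens_comp _ _ _ _ _ _ (I ⊗ f) (ABid 2) (ABid 0) A.
  have := ABtens_comp _ _ _ _ _ _ (ABid 2) (I ⊗ f) A (ABid 2).
  by rewrite !ABcomp1l !ABcomp1r f0 => <- <-.
rewrite rotated2 !ABcompA cap_cap -(ABcompA _ _ _ _ A) cap_through.
have := ABtens_comp _ _ _ _ _ _ I I (I ⊗ A) (U ⊗ I).
rewrite ABcomp1l snake ABtens_id => straight.
by rewrite -!ABcompA -straight ABcomp1r.
Qed.

(** The defining relation for the rotated dot, read through [cap_slide]. *)
Lemma cap_slide_dot : A ∘ y = - (A ∘ x).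
Proof. by rewrite -cap_slide dot_rotate ABtensNl ABcompNr. Qed.

Lemma dots_comm : y ∘ x = x ∘ y.
Proof.
have := ABtens_comp _ _ _ _ _ _ I X X I.
have := ABtens_comp _ _ _ _ _ _ X I I X.
by rewrite !ABcomp1l !ABcomp1r => <- <-.
Qed.

(** Dots on the right strand commute with those on the left one, so they can
    reach the cap one at a time, each changing the sign when it slides over. *)
Lemma cap_dots a b :
  A ∘ ABpow x a ∘ ABpow y b = (-1) ^+ b *: (A ∘ ABpow x (a + b)).
Proof.
elim: b a => [|b IHb] a; first by rewrite addn0 scale1r ABcomp1r.
rewrite ABpowS ABcompA -(ABcompA _ _ _ _ A) -(ABpow_comm _ y x a dots_comm).
rewrite (ABcompA _ _ _ _ A) cap_slide_dot 2!ABcompNl -(ABcompA _ _ _ _ A) -ABpowS.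
by rewrite IHb addSnnS exprS mulN1r scaleNr.
Qed.

(** * The loop with one crossing *)

Definition crossed_loop a b : hom 0 0 := A ∘ ABpow x a ∘ S ∘ ABpow y b ∘ U.

(** The two loops differ in the position of one dot relative to the crossing, so
    [dot_crossing] leaves the term [U ∘ A], which cuts the loop into two, and the
    term [- 1], which removes the crossing.  In both, [cap_dots] moves the [b]
    dots to the left strand. *)
Lemma crossed_loop_step a b :
  crossed_loop a.+1 b - crossed_loop a b.+1
  = (-1) ^+ b *: (Delta a ∘ Delta b - Delta (a + b)).
Proof.
have split_loop : A ∘ ABpow x a ∘ (U ∘ A) ∘ ABpow y b ∘ U
    = (-1) ^+ b *: (Delta a ∘ Delta b).
  rewrite ABcompA -!(ABcompA _ _ _ _ (A ∘ ABpow x a ∘ U)).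
  have := cap_dots 0 b; rewrite ABcomp1r add0n => ->.
  by rewrite ABcompZl ABcompZr.
rewrite scalerBr -split_loop /crossed_loop ABpowSr (ABpowS _ y) !ABcompA.
rewrite -(ABcompA _ _ _ _ (A ∘ ABpow x a) S y).
rewrite -(ABcompA _ _ _ _ (A ∘ ABpow x a) x S) dot_crossing.
(* The term [S ∘ y] of [dot_crossing] cancels [crossed_loop a b.+1]. *)
rewrite ABcompDr 2!ABcompDl addrC addKr.
rewrite ABcompDr ABcompNr ABcomp1r 2!ABcompDl 2!ABcompNl cap_dots ABcompZl.
by rewrite !ABcompA.
Qed.

(** For even [k] the left side vanishes, and this becomes a relation among the
    products [Delta a ∘ Delta b]; for odd [k] it determines [2 Delta k]. *)
Lemma Delta_telescope k :
  Delta k - (-1) ^+ k *: Delta k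
  = \sum_(0 <= a < k)
      (-1) ^+ (k.-1 - a) *: (Delta a ∘ Delta (k.-1 - a) - Delta k.-1).
Proof.
have dots_left : crossed_loop k (k - k) = Delta k.
  by rewrite subnn /crossed_loop ABcomp1r -ABcompA crossing_cup.
have dots_right : crossed_loop 0 (k - 0) = (-1) ^+ k *: Delta k.
  have := cap_dots 0 k; rewrite subn0 /crossed_loop !ABcomp1r cap_crossing => ->.
  by rewrite ABcompZl.
rewrite -{1}dots_left -dots_right.
rewrite -(telescope_sumr (fun a => crossed_loop a (k - a)) (leq0n k)).
apply: eq_big_nat => a /andP[_ lt_ak].
have -> : (k - a = (k.-1 - a).+1)%N by rewrite -predn_sub prednK // subn_gt0.
by rewrite subnS predn_sub crossed_loop_step subnKC // -ltnS (ltn_predK lt_ak).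
Qed.

End Category.

Lemma sum_alternating_signs (R : pzRingType) k :
  \sum_(0 <= a < k) (-1) ^+ a = (odd k)%:R :> R.
Proof.
elim: k => [|k IHk]; first by rewrite big_geq.
rewrite big_nat_recr //= IHk -signr_odd.
by case: (odd k); rewrite ?subrr ?add0r.
Qed.

Theorem lemma3p4 (K : comPzRingType) (half2 : exists half : K, 2%:R * half = 1)
    (k : nat) (k_gt0 : (0 < k)%N) (k_odd : odd k) :
  2%:R *: Delta k =
    - Delta (k - 1)%N
    + \sum_(1 <= j < k.+1)
        (-1) ^+ (j - 1)%N *: (Delta (j - 1)%N ∘ Delta (k - j)%N)%AB :> ABhom K 0 0.
Proof.
have -> : 2%:R *: Delta k = Delta k - (-1) ^+ k *: Delta k :> ABhom K 0 0.
  by rewrite -signr_odd k_odd scaleN1r opprK scaler_nat mulr2n.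
have signs a : (a < k)%N -> (-1) ^+ (k.-1 - a) = (-1) ^+ a :> K.
  move=> lt_ak; have le_ak : (a <= k.-1)%N by rewrite -ltnS prednK.
  by rewrite -signr_odd oddB // -subn1 oddB // k_odd /= signr_odd.
have -> : - Delta (k - 1) = \sum_(0 <= a < k) (-1) ^+ a *: - Delta k.-1 :> ABhom K 0 0.
  by rewrite -scaler_suml sum_alternating_signs k_odd scale1r subn1.
rewrite Delta_telescope big_add1 -big_split; apply: eq_big_nat => a /andP[_ lt_ak].
by rewrite signs // subn1 subnS predn_sub scalerDr addrC.
Qed.
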